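(* Let $\mathcal{A}$ be $\mathcal{H}_n$, $\mathcal{C}_n$ or $\mathbf{\Gamma}_n$. Then $\mathrm{Log}_{\mathcal{A}}(z) = \log(|z|) + \mathrm{Arg}(z)$ for all $z\in\mathrm{Ld}(\mathcal{A})$.
   Context: $\mathcal{H}_n = \mathbb{R}[j]/\langle j^n-1\rangle$, $\mathcal{C}_n = \mathbb{R}[i]/\langle i^n+1\rangle$, $\mathbf{\Gamma}_n = \mathbb{R}[\epsilon]/\langle\epsilon^n\rangle$; $k$ denotes the respective generator $j,i,\epsilon$, and $\beta=\{1,k,\dots,k^{n-1}\}$. The exponential on $\mathcal{A}$ is $e^z=\sum_{m=0}^\infty z^m/m!$ and $\mathrm{Ld}(\mathcal{A})$ is the image of $\exp:\mathcal{A}\to\mathcal{A}$. $M_\beta(z)$ is the matrix with respect to $\beta$ of left-multiplication $x\mapsto zx$, $F(z)=\det(M_\beta(z))$, and the modulus of $z\in\mathrm{Ld}(\mathcal{A})$ is $|z|=\sqrt[n]{F(z)}$ (on $\mathrm{Ld}(\mathcal{A})$ one has $F(z)>0$, and the positive real $n$-th root is taken). Logarithm: if $\mathcal{A}$ is semisimple (as for $\mathcal{H}_n$, $\mathcal{C}_n$), fix an algebra isomorphism $\phi:\mathcal{A}\to\mathbb{R}^r\times\mathbb{C}^m$ and, for each complex factor, a choice of branch of the complex logarithm, i.e. a set $B_i\subseteq\mathbb{C}$ on which the complex exponential restricts to a bijection onto $\mathbb{C}^\times$. For $w\in\mathrm{Ld}(\mathcal{A})$, $\mathrm{Log}_{\mathcal{A}}(w)$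 is the unique element $x_1+k\theta_1+\dots+k^{n-1}\theta_{n-1}$ of $\phi^{-1}(\mathbb{R}^r\times B_1\times\dots\times B_m)$ (with $x_1,\theta_i\in\mathbb{R}$) whose exponential is $w$. For $\mathcal{A}=\mathbf{\Gamma}_n$, $\mathrm{Log}_{\mathcal{A}}$ is the unique inverse of $\exp$ on $\mathrm{Ld}(\mathcal{A})$. Argument: writing $\mathrm{Log}_{\mathcal{A}}(w) = x_1+k\theta_1+\dots+k^{n-1}\theta_{n-1}$ with $x_1,\theta_i\in\mathbb{R}$, one defines $\mathrm{Arg}(w) = k\theta_1+k^2\theta_2+\dots+k^{n-1}\theta_{n-1}$. *)

(* Defs.v *)
From HB Require Import structures.
From mathcomp Require Import all_boot all_order all_algebra.
From mathcomp Require Import qpoly complex.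
From mathcomp Require Import all_classical all_reals all_analysis.

Set Implicit Arguments.
Unset Strict Implicit.
Unset Printing Implicit Defensive.

Import Order.TTheory GRing.Theory Num.Theory numFieldNormedType.Exports.
Local Open Scope classical_set_scope.
Local Open Scope ring_scope.

(* The algebras R[k]/<p> are the types {poly %/ p}, for p one of
   'X^n - 1, 'X^n + 1 and 'X^n with n > 0: each of these p is monic of
   positive degree, which is what {poly %/ p} needs to be the actual quotient
   by p. The generator k is 'qX, the class of 'X. *)
Section PolyQuotient.
Variables (R : realType) (n : nat) (p : {poly R}).
Local Notation A := {poly %/ p}.
Local Notation k := ('qX : A).

(* An element of A is stored as its representative of size at most n, so that
   its coefficients are its coordinates in the basis 1, k, ..., k^(n-1). *)
Definition qcoord (z : A) (i : nat) : R := (z : {poly R})`_i.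

(* The sum of z^m / m! for the topology of the finite dimensional real vector
   space A, that is, coordinate by coordinate. *)
Definition expA (z : A) : A :=
  \sum_(i < n)
    limn (series (fun m => qcoord ((m`!%:R)^-1 *: z ^+ m) i)) *: k ^+ i.

Definition Ld : set A := range expA.

(* Column j holds the coordinates of z * k^j. *)
Definition Mbeta (z : A) : 'M[R]_n :=
  \matrix_(i < n, j < n) qcoord (z * k ^+ j) i.

(* For a > 0, a `^ n%:R^-1 is the positive n-th root of a. *)
Definition modulus (z : A) : R := \det (Mbeta z) `^ n%:R^-1.

(* The inverse of expA with values in D. It is meant for those D on which expA
   is injective with image Ld: for w in Ld there is then exactly one such u. *)
Definition LogA (D : set A) (w : A) : A :=
  xget 0 [set u | D u /\ expA u = w].

Definition ArgA (D : set A) (w : A) : A :=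
  \sum_(1 <= i < n) qcoord (LogA D w) i *: k ^+ i.

End PolyQuotient.

Definition expC (R : realType) (z : R[i]) : R[i] :=
  Complex (limn (series (fun m => complex.Re (z ^+ m / m`!%:R))))
          (limn (series (fun m => complex.Im (z ^+ m / m`!%:R)))).

Definition is_log_branch (R : realType) (B : set R[i]) : Prop :=
  set_bij B [set w | w != 0] (@expC R).

(* The algebra R^r x C^m over R, with componentwise operations; Rcomplex R is
   R[i] viewed as an algebra over R. *)
Notation RrCm R r m :=
  ({ffun 'I_r -> R} * {ffun 'I_m -> Rcomplex R})%type.

Definition branch_domain (R : realType) (p : {poly R}) (r m : nat)
    (phi : {poly %/ p} -> RrCm R r m) (B : 'I_m -> set R[i]) :
    set {poly %/ p} :=
  phi @^-1` [set xb : RrCm R r m | forall i, B i (xb.2 i)].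

(* Main.v *)
(* The logarithm of z is an element u with e^u = z, and Arg z is u minus its
   coordinate u_0 on 1, so one has to show |e^u| = e^{u_0}, which follows from
   det(e^M) = e^{tr M} for M = M_beta(u): as k^n is a scalar, multiplication by
   k^i has trace 0 for 0 < i < n, hence tr M = n u_0. For the determinant
   identity, let the x range over the complex eigenvalues of M; the partial sums
   S_N of the exponential series satisfy det(S_N(M)) = prod_x S_N(x), and
   N -> oo gives det(e^M) = prod_x e^x = e^{tr M}.
   In the semisimple case u exists because phi transports exp to the
   componentwise exponential, so that each complex component of a preimage of z
   may be replaced by the element of B_i with the same, nonzero, exponential. *)
Require Import Defs.
From HB Require Import structures.
From mathcomp Require Import all_boot all_order all_algebra.
From mathcomp Require Import qpoly complex.
From mathcomp Require Import all_classical all_reals all_analysis.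

Set Implicit Arguments.
Unset Strict Implicit.
Unset Printing Implicit Defensive.

Import Order.TTheory GRing.Theory Num.Theory numFieldNormedType.Exports.
Local Open Scope classical_set_scope.
Local Open Scope ring_scope.

(** * The complex exponential *)

(** Exchanging the sums over [m] and [i] and substituting [m = i + j] turns antidiagonals into rows;
    the Cauchy product below is sorted this way. *)
Lemma sum_antidiagonal (V : nmodType) (N : nat) (f : nat -> nat -> V) :
  \sum_(m < N) \sum_(i < m.+1) f i (m - i)%N =
  \sum_(i < N) \sum_(j < N | (i + j < N)%N) f i j.
Proof.
transitivity (\sum_(m < N) \sum_(i < N | (i <= m)%N) f i (m - i)%N).
  apply: eq_bigr => m _.
  by rewrite (big_ord_widen N (fun i => f i (m - i)%N)).
rewrite (exchange_big_dep predT) //=; apply: eq_bigr => i _.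
case: i => i iN /=.
rewrite -(big_mkord (fun m => (i <= m)%N) (fun m => f i (m - i)%N)).
rewrite -(big_mkord (fun j => (i + j < N)%N) (fun j => f i j)).
rewrite (big_cat_nat (n := i)) //=; last exact: ltnW iN.
rewrite big_nat_cond big_pred0 ?add0r => [|m]; last first.
  by case: leqP => //= im; rewrite leqNgt im.
rewrite -[X in index_iota X N]add0n big_addn.
rewrite [RHS](big_cat_nat (n := (N - i)%N)) //= ?leq_subr //.
rewrite [X in _ = _ + X]big_nat_cond [X in _ = _ + X]big_pred0 ?addr0 => [|m].
  rewrite big_nat_cond [RHS]big_nat_cond; apply: eq_big => [m|m _].
    by rewrite leq_addl /= andbT andb_idr // ltn_subRL.
  by rewrite addnK.
by rewrite leq_subLR leqNgt; case: ltnP; rewrite //= andbF.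
Qed.

(** The field is left arbitrary so that real and complex partial sums can be compared directly. *)
Definition exp_sum {F : fieldType} (x : F) (N : nat) : F :=
  \sum_(m < N) x ^+ m / m`!%:R.

(** The product runs over the full square of pairs, while by the binomial theorem the sum at [x + y]
    runs over the triangle [i + j < N]; the rest of the square remains. *)
Lemma exp_sumM_sub (F : numFieldType) (x y : F) (N : nat) :
  exp_sum x N * exp_sum y N - exp_sum (x + y) N =
  \sum_(i < N) \sum_(j < N | (N <= i + j)%N)
    (x ^+ i / i`!%:R) * (y ^+ j / j`!%:R).
Proof.
have -> : exp_sum (x + y) N = \sum_(i < N) \sum_(j < N | (i + j < N)%N)
    (x ^+ i / i`!%:R) * (y ^+ j / j`!%:R).
  rewrite -(@sum_antidiagonal _ N
    (fun i j => (x ^+ i / i`!%:R) * (y ^+ j / j`!%:R))).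
  apply: eq_bigr => m _; rewrite addrC exprDn mulr_suml; apply: eq_bigr => i _.
  have f0 k : k`!%:R != 0 :> F by rewrite pnatr_eq0 -lt0n fact_gt0.
  have im : (i <= m)%N by rewrite -ltnS.
  rewrite -(bin_fact im) !natrM -mulr_natr.
  have b0 : 'C(m, i)%:R != 0 :> F by rewrite pnatr_eq0 -lt0n bin_gt0.
  rewrite !invfM mulrACA [X in _ = X]mulrACA [y ^+ _ * x ^+ _]mulrC.
  by rewrite mulrA mulfVK.
rewrite big_distrlr /= -sumrB; apply: eq_bigr => i _.
rewrite (bigID (fun j : 'I_N => (i + j < N)%N)) /= addrAC subrr add0r.
by apply: eq_bigl => j; rewrite -leqNgt.
Qed.

(** Each term of the remainder is a monomial in [x] and [y] with a positive coefficient, so the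
    triangle inequality replaces [x] and [y] by their norms. *)
Lemma norm_exp_sumM_sub (F : numFieldType) (x y : F) (N : nat) :
  `|exp_sum x N * exp_sum y N - exp_sum (x + y) N| <=
  exp_sum `|x| N * exp_sum `|y| N - exp_sum (`|x| + `|y|) N.
Proof.
rewrite !exp_sumM_sub; apply: (le_trans (ler_norm_sum _ _ _)).
apply: ler_sum => i _; apply: (le_trans (ler_norm_sum _ _ _)).
apply: ler_sum => j _.
by rewrite !(normrM, normfV, normrX) !normr_nat.
Qed.

Lemma cvg_exp_sum (R : realType) (x : R) : exp_sum x N @[N --> \oo] --> expR x.
Proof.
have -> : exp_sum x = series (exp_coeff x).
  by apply/funext => N; rewrite /exp_sum /series /= big_mkord.
exact: is_cvg_series_exp_coeff.
Qed.

Section ComplexExp.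
Variable R : realType.
Implicit Types (z w : R[i]) (u v : nat -> R[i]).

(** Convergence is split into real and imaginary parts to match the two limits that define
    [expC]. *)
Definition ccvg u z : Prop :=
  (complex.Re (u N) @[N --> \oo] --> complex.Re z) /\
  (complex.Im (u N) @[N --> \oo] --> complex.Im z).

Lemma ccvg_unique u z w : ccvg u z -> ccvg u w -> z = w.
Proof.
move=> [uz1 uz2] [uw1 uw2].
have e1 : complex.Re z = complex.Re w.
  by rewrite -(cvg_lim _ uz1) // (cvg_lim _ uw1).
have e2 : complex.Im z = complex.Im w.
  by rewrite -(cvg_lim _ uz2) // (cvg_lim _ uw2).
by case: z w e1 e2 {uz1 uz2 uw1 uw2} => a b [c d] /= -> ->.
Qed.

Lemma ccvgM u v z w : ccvg u z -> ccvg v w -> ccvg (fun N => u N * v N) (z * w).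
Proof.
have ReM a b : complex.Re (a * b : R[i]) =
  complex.Re a * complex.Re b - complex.Im a * complex.Im b.
  by case: a b => ? ? [].
have ImM a b : complex.Im (a * b : R[i]) =
  complex.Re a * complex.Im b + complex.Im a * complex.Re b.
  by case: a b => ? ? [].
move=> [u1 u2] [v1 v2]; split.
  rewrite ReM (_ : (fun _ => _) = (fun N =>
    complex.Re (u N) * complex.Re (v N) - complex.Im (u N) * complex.Im (v N)));
    last by apply/funext => N.
  by apply: cvgB; apply: cvgM.
rewrite ImM (_ : (fun _ => _) = (fun N =>
  complex.Re (u N) * complex.Im (v N) + complex.Im (u N) * complex.Re (v N)));
  last by apply/funext => N.
by apply: cvgD; apply: cvgM.
Qed.

Lemma ccvg_prod (I : Type) (s : seq I) (u : I -> nat -> R[i]) (l : I -> R[i]) :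
  (forall x, ccvg (u x) (l x)) ->
  ccvg (fun N => \prod_(x <- s) u x N) (\prod_(x <- s) l x).
Proof.
move=> ul; elim: s => [|x s IHs].
  rewrite big_nil (_ : (fun _ => _) = cst 1); last first.
    by apply/funext => N; rewrite big_nil.
  by split; apply: cvg_cst.
rewrite big_cons (_ : (fun _ => _) = (fun N => u x N * \prod_(y <- s) u y N)).
  exact: ccvgM.
by apply/funext => N; rewrite big_cons.
Qed.

Lemma ccvg_real (u : nat -> R) (x : R) :
  u N @[N --> \oo] --> x -> ccvg (fun N => (u N)%:C%C) x%:C%C.
Proof. by move=> ux; split => //=; apply: cvg_cst. Qed.

Lemma ler_Re_normc z : `|complex.Re z| <= complex.Re `|z|.
Proof. by have := normc_ge_Re z; rewrite lecE => /andP[]. Qed.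

Lemma ler_Im_normc z : `|complex.Im z| <= complex.Re `|z|.
Proof.
have := ler_Re_normc (z * 'i%C); rewrite ReiNIm normrN normrM.
by rewrite [`|'i%C|]normc_def /= expr0n add0r expr1n sqrtr1 mulr1 mulr0 subr0.
Qed.

Lemma Re_norm_real z : (complex.Re `|z|)%:C%C = `|z|.
Proof. by rewrite normc_def. Qed.

Lemma ccvg_subr0 u v z : ccvg u z ->
  complex.Re `|u N - v N| @[N --> \oo] --> (0 : R) -> ccvg v z.
Proof.
move=> [u1 u2] uv.
have ReB a b : complex.Re (a - b : R[i]) = complex.Re a - complex.Re b.
  by case: a b => ? ? [].
have ImB a b : complex.Im (a - b : R[i]) = complex.Im a - complex.Im b.
  by case: a b => ? ? [].
have d0 (f : nat -> R) : (forall N, `|f N| <= complex.Re `|u N - v N|) ->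
    f N @[N --> \oo] --> (0 : R).
  move=> fle; apply/norm_cvg0P.
  apply: (@squeeze_cvgr _ _ _ _ (fun=> 0) (fun N => complex.Re `|u N - v N|)).
  - by apply: nearW => N; rewrite normr_ge0 fle.
  - exact: cvg_cst.
  - exact: uv.
split.
  rewrite (_ : (fun _ => _) = (fun N => complex.Re (u N) -
    complex.Re (u N - v N))); last by apply/funext => N; rewrite ReB subKr.
  rewrite -[X in _ --> X]subr0; apply: cvgB => //.
  by apply: d0 => N; exact: ler_Re_normc.
rewrite (_ : (fun _ => _) = (fun N => complex.Im (u N) -
  complex.Im (u N - v N))); last by apply/funext => N; rewrite ImB subKr.
rewrite -[X in _ --> X]subr0; apply: cvgB => //.
by apply: d0 => N; exact: ler_Im_normc.
Qed.

Lemma exp_sum_real (x : R) N : (exp_sum x N)%:C%C = exp_sum (x%:C%C : R[i]) N.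
Proof.
rewrite /exp_sum rmorph_sum; apply: eq_bigr => m _.
by rewrite rmorphM fmorphV rmorphXn rmorph_nat.
Qed.

Lemma cvg_series_norm_le (f : nat -> R) (c : R) :
  (forall m, `|f m| <= c ^+ m / m`!%:R) -> cvgn (series f).
Proof.
move=> fle; apply: normed_cvg.
apply: (@series_le_cvg _ _ (exp_coeff c)) => //.
- by move=> m /=; exact: normr_ge0.
- by move=> m; apply: le_trans (normr_ge0 _) (fle m).
- exact: is_cvg_series_exp_coeff.
Qed.

(** Both parts of the [m]-th term are bounded by [|z|^m / m!], so both real series converge
    absolutely and the limits in [expC] are genuine. *)
Lemma ccvg_exp_sum z : ccvg (exp_sum z) (expC z).
Proof.
have nle m : complex.Re `|z ^+ m / m`!%:R| = (complex.Re `|z|) ^+ m / m`!%:R.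
  apply: complexI; rewrite Re_norm_real rmorphM fmorphV rmorphXn rmorph_nat.
  by rewrite /= Re_norm_real normrM normfV normrX normr_nat.
split => /=.
  rewrite (_ : (fun _ => _) = series (fun m => complex.Re (z ^+ m / m`!%:R))).
    apply: (@cvg_series_norm_le _ (complex.Re `|z|)) => m.
    by rewrite -nle ler_Re_normc.
  apply/funext => N; rewrite /series /= big_mkord /exp_sum.
  by rewrite (raddf_sum (@complex.Re R : Rcomplex R -> R)).
rewrite (_ : (fun _ => _) = series (fun m => complex.Im (z ^+ m / m`!%:R))).
  apply: (@cvg_series_norm_le _ (complex.Re `|z|)) => m.
  by rewrite -nle ler_Im_normc.
apply/funext => N; rewrite /series /= big_mkord /exp_sum.
by rewrite (raddf_sum (@complex.Im R : Rcomplex R -> R)).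
Qed.

Lemma expC_real (x : R) : expC x%:C%C = (expR x)%:C%C.
Proof.
apply: ccvg_unique (ccvg_exp_sum _) _.
rewrite (_ : exp_sum _ = (fun N => (exp_sum x N)%:C%C)).
  exact/ccvg_real/cvg_exp_sum.
by apply/funext => N; rewrite exp_sum_real.
Qed.

(* The defect of multiplicativity of the partial sums at z, w is dominated by the
   one at |z|, |w|, which tends to 0 by the real case. *)
Lemma expCD z w : expC (z + w) = expC z * expC w.
Proof.
apply: ccvg_unique (ccvg_exp_sum _) _.
apply: (ccvg_subr0 (ccvgM (ccvg_exp_sum z) (ccvg_exp_sum w))).
set a := complex.Re `|z|; set b := complex.Re `|w|.
apply: (@squeeze_cvgr _ _ _ _ (fun=> 0)
  (fun N => exp_sum a N * exp_sum b N - exp_sum (a + b) N)).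
- apply: nearW => N; rewrite -!lecR Re_norm_real normr_ge0 /=.
  apply: (le_trans (norm_exp_sumM_sub _ _ _)).
  rewrite rmorphB rmorphM /= !exp_sum_real rmorphD /=.
  by rewrite /a /b !Re_norm_real.
- exact: cvg_cst.
- rewrite -(subrr (expR (a + b))) {1}expRD.
  by apply: cvgB; [apply: cvgM|]; apply: cvg_exp_sum.
Qed.

Lemma expC0 : expC (0 : R[i]) = 1.
Proof. by have := expC_real 0; rewrite expR0. Qed.

Lemma expC_neq0 z : expC z != 0.
Proof.
apply/eqP => ez; have := expCD z (- z).
by rewrite subrr expC0 ez mul0r => /eqP; rewrite oner_eq0.
Qed.

Lemma expC_sum (I : Type) (s : seq I) (f : I -> R[i]) :
  expC (\sum_(x <- s) f x) = \prod_(x <- s) expC (f x).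
Proof. exact: (big_morph _ expCD expC0). Qed.

End ComplexExp.

(** * Determinants of matrix exponentials *)

(** Here [s] lists the roots of the characteristic polynomial with multiplicity. Splitting [q] into
    linear factors reduces the claim to [det (A - y) = prod_x (x - y)], and the two products are
    then exchanged. *)
Lemma det_horner_mx_eigen (F : closedFieldType) (n : nat) (A : 'M[F]_n.+1) :
  exists2 s : seq F, \sum_(x <- s) x = \tr A &
    forall q : {poly F}, \det (horner_mx A q) = \prod_(x <- s) q.[x].
Proof.
have [s As] := closed_field_poly_normal (char_poly A).
rewrite (monicP (char_poly_monic A)) scale1r in As.
have size_s : size s = n.+1.
  by have := size_char_poly A; rewrite As size_prod_XsubC => -[].
exists s => [|q].
  (* Minus the trace and minus the sum of the roots are both the subleading coefficient. *)
  apply: oppr_inj; rewrite -(char_poly_trace A (ltn0Sn n)) As -size_s.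
  by rewrite coefPn_prod_XsubC // size_s.
have [t ->] := closed_field_poly_normal q.
have detX y : \det (horner_mx A ('X - y%:P)) = \prod_(x <- s) (x - y).
  rewrite rmorphB /= horner_mx_X horner_mx_C -opprB -scaleN1r detZ.
  have -> : \det (y%:M - A) = (char_poly A).[y].
    rewrite /char_poly -[RHS]/(horner_eval y _) -det_map_mx; congr (\det _).
    apply/matrixP => i j; rewrite !mxE /= -[RHS]/(horner _ y).
    by rewrite hornerD hornerN hornerMn hornerX hornerC.
  rewrite As horner_prod - {1}size_s.
  elim: s {As size_s} => [|x s IHs] /=; first by rewrite !big_nil mulr1.
  by rewrite !big_cons exprS mulrACA IHs mulN1r hornerXsubC opprB.
(* The leading coefficient of [q] leaves the determinant with exponent [n.+1 = size s], hence once
   for each eigenvalue. *)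
rewrite linearZ /= detZ rmorph_prod.
rewrite (big_morph (@determinant F n.+1) (@det_mulmx _ _) (det1 _ _)).
rewrite (eq_bigr _ (fun y _ => detX y)) exchange_big /= -size_s.
under [RHS]eq_bigr do rewrite hornerZ horner_prod.
rewrite big_split /= big_const_seq count_predT iter_mulr_1; congr (_ * _).
by apply: eq_bigr => x _; apply: eq_bigr => y _; rewrite hornerXsubC.
Qed.

Lemma cvg_det_exp_sum (R : realType) (n : nat) (M : 'M[R]_n.+1) :
  \det (\sum_(m < N) m`!%:R^-1 *: M ^+ m) @[N --> \oo] --> expR (\tr M).
Proof.
have [s s_tr s_det] := det_horner_mx_eigen (map_mx (real_complex R) M).
(* The eigenvalues may be non-real, so convergence is proved over the complex numbers; its real part
   is the goal. *)
suff [] : ccvg (fun N => (\det (\sum_(m < N) m`!%:R^-1 *: M ^+ m))%:C%C)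
  (expR (\tr M))%:C%C by [].
rewrite -expC_real -trace_map_mx -s_tr expC_sum.
rewrite (_ : (fun _ => _) = (fun N => \prod_(x <- s) exp_sum x N)).
  by apply: ccvg_prod => x; exact: ccvg_exp_sum.
apply/funext => N; rewrite -det_map_mx.
transitivity (\det (horner_mx (map_mx (real_complex R) M)
    (\sum_(m < N) m`!%:R^-1 *: 'X^m))); last first.
  rewrite s_det; apply: eq_bigr => x _; rewrite horner_sum.
  by apply: eq_bigr => m _; rewrite hornerZ hornerXn mulrC.
rewrite !raddf_sum; congr (\det _); apply: eq_bigr => m _ /=.
rewrite map_mxZ fmorphV rmorph_nat linearZ /=.
by rewrite !rmorphXn /= horner_mx_X.
Qed.

Lemma cvg_det (R : realType) (n : nat) (u : nat -> 'M[R]_n) (l : 'M[R]_n) :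
  (forall i j, u N i j @[N --> \oo] --> l i j) ->
  \det (u N) @[N --> \oo] --> \det l.
Proof.
move=> ul; rewrite /determinant.
apply: cvg_big => [|s _]; first exact: add_continuous.
apply: cvgM; first exact: cvg_cst.
by apply: cvg_big => [|i _]; [exact: mul_continuous | exact: ul].
Qed.

(** * Exponential and multiplication matrices in R[k]/<p> *)

(** Linearity is a hypothesis here, so these facts apply to matrix entries and components of [phi]
    without bundling each as a linear form. *)
Lemma scalar_fun0 (R : pzRingType) (V : lmodType R) (f : V -> R) :
  scalar f -> f 0 = 0.
Proof.
by move=> lf; have := lf (-1) 0 0; rewrite scaler0 addr0 mulN1r addNr.
Qed.

Lemma scalar_funZ (R : pzRingType) (V : lmodType R) (f : V -> R) a x :
  scalar f -> f (a *: x) = a * f x.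
Proof. by move=> lf; rewrite -[a *: x]addr0 lf (scalar_fun0 lf) addr0. Qed.

Lemma scalar_fun_sum (R : pzRingType) (V : lmodType R) (f : V -> R) (I : Type)
    (r : seq I) (P : pred I) (F : I -> V) :
  scalar f -> f (\sum_(i <- r | P i) F i) = \sum_(i <- r | P i) f (F i).
Proof.
move=> lf; apply: big_morph => [x y|]; last exact: scalar_fun0.
by rewrite -[x]scale1r lf mul1r scale1r.
Qed.

Section QuotientAlgebra.
Variables (R : realType) (n : nat) (p : {poly R}).
Hypotheses (p_monic : p \is monic) (size_p : size p = n.+1) (n_gt0 : (0 < n)%N).
Local Notation A := {poly %/ p}.
Local Notation k := ('qX : A).

(** The quotient type is built on [mk_monic p], which falls back to a default polynomial unless [p]
    is monic of positive degree. *)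
Lemma mk_monic_id : mk_monic p = p.
Proof. by rewrite /mk_monic size_p p_monic ltnS n_gt0. Qed.

Lemma qcoord_is_scalar i : scalar (fun z : A => qcoord z i).
Proof. by move=> a z w; rewrite /qcoord /= coefD coefZ. Qed.

Lemma qcoordZ a (z : A) i : qcoord (a *: z) i = a * qcoord z i.
Proof. exact: coefZ. Qed.

Lemma qcoord_bigsum (I : Type) (r : seq I) (P : pred I) (F : I -> A) i :
  qcoord (\sum_(j <- r | P j) F j) i = \sum_(j <- r | P j) qcoord (F j) i.
Proof. exact: coefn_sum. Qed.

Lemma qX_exp i : (i < n)%N -> k ^+ i = 'X^i :> {poly R}.
Proof.
move=> i_n; rewrite /qpolyX -rmorphXn in_qpoly_small //.
by rewrite mk_monic_id size_p size_polyXn ltnS.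
Qed.

Lemma qcoord_qX i j : (i < n)%N -> qcoord (k ^+ i) j = (j == i)%:R.
Proof. by move=> i_n; rewrite /qcoord qX_exp // coefXn. Qed.

Lemma qcoord_sum (a : nat -> R) i : (i < n)%N ->
  qcoord (\sum_(j < n) a j *: k ^+ j) i = a i.
Proof.
move=> i_n; rewrite qcoord_bigsum (bigD1 (Ordinal i_n)) //= big1 => [|j ji].
  by rewrite addr0 qcoordZ qcoord_qX // eqxx mulr1.
by rewrite qcoordZ qcoord_qX // eq_sym (negPf (ji : (j : nat) != i)) mulr0.
Qed.

Lemma qcoordK (z : A) : \sum_(i < n) qcoord z i *: k ^+ i = z.
Proof.
apply/npolyP => i; have [i_n|n_i] := ltnP i n; first exact: qcoord_sum.
by rewrite !big_coef_npoly // mk_monic_id size_p.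
Qed.

Lemma Mbeta_is_linear : linear (@Mbeta R n p).
Proof.
move=> a z w; apply/matrixP => i j; rewrite !mxE mulrDl -scalerAl.
exact: (qcoord_is_scalar i).
Qed.

HB.instance Definition _ := GRing.isLinear.Build R A 'M[R]_n *:%R
  (@Mbeta R n p) Mbeta_is_linear.

Lemma Mbeta1 : Mbeta n (1 : A) = 1%:M.
Proof. by apply/matrixP => i j; rewrite !mxE mul1r qcoord_qX. Qed.

(** Column [j] holds [z * (w * k^j)]; expanding the inner product in the basis gives the matrix
    product. *)
Lemma MbetaM (z w : A) : Mbeta n (z * w) = Mbeta n z *m Mbeta n w.
Proof.
apply/matrixP => i j; rewrite !mxE -mulrA - {1}[w * _]qcoordK mulr_sumr.
rewrite qcoord_bigsum; apply: eq_bigr => l _.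
by rewrite -scalerAr !mxE qcoordZ mulrC.
Qed.

(** The constant [c] is the sum of the absolute values of all entries of the matrix of [z]. It
    dominates every row sum, so by induction [c^m] bounds the entries of the matrix of [z^m]. *)
Lemma norm_qcoord_expr_le (z : A) :
  exists c : R, forall i m, (i < n)%N -> `|qcoord (z ^+ m) i| <= c ^+ m.
Proof.
pose c := \sum_i \sum_j `|Mbeta n z i j|; exists c => i m i_n.
have row_le l : \sum_j `|Mbeta n z l j| <= c.
  rewrite /c [leRHS](bigD1 l) //= lerDl; apply: sumr_ge0 => a _.
  by apply: sumr_ge0.
have c_ge0 : 0 <= c by apply: sumr_ge0 => a _; apply: sumr_ge0.
suff M_le (a b : 'I_n) : `|Mbeta n (z ^+ m) a b| <= c ^+ m.
  (* Column 0 of the matrix of [z^m] holds the coordinates of [z^m], since [k^0 = 1]. *)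
  have := M_le (Ordinal i_n) (Ordinal n_gt0).
  by rewrite mxE expr0 mulr1.
elim: m a b => [|m IHm] a b.
  by rewrite !expr0 Mbeta1 mxE; case: eqP; rewrite ?normr1 ?normr0.
rewrite !exprS MbetaM mxE; apply: (le_trans (ler_norm_sum _ _ _)).
apply: (@le_trans _ _ ((\sum_j `|Mbeta n z a j|) * c ^+ m)).
  rewrite mulr_suml; apply: ler_sum => j _; rewrite normrM.
  by rewrite ler_wpM2l.
by rewrite ler_wpM2r // exprn_ge0.
Qed.

(** A linear form is a finite combination of coordinates, and the coordinate series converge by the
    geometric bound on powers, so it commutes with the exponential series. *)
Lemma cvg_expA (f : A -> R) (z : A) : scalar f ->
  series (fun m => f ((m`!%:R)^-1 *: z ^+ m)) N @[N --> \oo] --> f (expA n z).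
Proof.
move=> lf.
have fsum (a : nat -> R) :
    f (\sum_(i < n) a i *: k ^+ i) = \sum_(i < n) a i * f (k ^+ i).
  by rewrite scalar_fun_sum //; apply: eq_bigr => i _; rewrite scalar_funZ.
pose u i m := qcoord ((m`!%:R)^-1 *: z ^+ m) i.
rewrite /expA (fsum (fun i => limn (series (u i)))).
rewrite (_ : (fun _ => _) =
    (fun N => \sum_(i < n) series (u i) N * f (k ^+ i))); last first.
  apply/funext => N; rewrite /series /= !big_mkord.
  under [RHS]eq_bigr do rewrite big_mkord mulr_suml.
  rewrite exchange_big; apply: eq_bigr => m _ /=.
  by rewrite - {1}[_ *: _]qcoordK (fsum (fun i => u i m)).
apply: cvg_big => // [|i _]; first exact: add_continuous.
apply: cvgM; last exact: cvg_cst.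
have [c zc] := norm_qcoord_expr_le z.
apply: (@cvg_series_norm_le _ _ c) => m.
by rewrite /u qcoordZ mulrC normrM normfV normr_nat ler_wpM2r // zc.
Qed.

End QuotientAlgebra.

(** Both sides are limits of the determinants of the partial sums at [Mbeta n z]: one by the
    eigenvalue argument, the other because each matrix entry is a linear form on the algebra. *)
Lemma det_Mbeta_expA (R : realType) (n : nat) (p : {poly R}) (z : {poly %/ p}) :
  p \is monic -> size p = n.+1 -> (0 < n)%N ->
  \det (Mbeta n (expA n z)) = expR (\tr (Mbeta n z)).
Proof.
case: n => // n p_monic size_p _.
rewrite -(cvg_lim _ (@cvg_det_exp_sum R n (Mbeta n.+1 z))) //.
apply/esym/cvg_lim => //.
apply: cvg_det => i j.
pose f (w : {poly %/ p}) := Mbeta n.+1 w i j.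
have lf : scalar f by move=> a v w; rewrite /f linearP !mxE.
rewrite (_ : (fun _ => _) = series (fun m => f ((m`!%:R)^-1 *: z ^+ m))).
  exact: cvg_expA.
apply/funext => N; rewrite /series /= big_mkord summxE; apply: eq_bigr => m _.
rewrite /f linearZ /=; congr (fun_of_matrix (_ *: _) i j).
elim: (m : nat) => [|l IHl]; first by rewrite !expr0 Mbeta1.
by rewrite !exprS MbetaM // IHl.
Qed.

Lemma mxtrace_Mbeta (R : realType) (n : nat) (c : R)
    (z : {poly %/ ('X^n - c%:P)}) :
  (0 < n)%N -> \tr (Mbeta n z) = n%:R * qcoord z 0.
Proof.
set p := 'X^n - c%:P in z * => n_gt0.
have size_p : size p = n.+1 by exact: size_XnsubC.
have p_monic : p \is monic by exact: monicXnsubC.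
have kn : 'qX ^+ n = c *: 1 :> {poly %/ p}.
  have p0 : in_qpoly p p = 0.
    apply: val_inj; rewrite /= (mk_monic_id p_monic size_p) //.
    by rewrite Pdiv.RingMonic.rmodpp.
  apply: subr0_eq; rewrite -[RHS]p0 /qpolyX -rmorphXn.
  transitivity (in_qpoly p ('X^n - c%:P)) => //.
  by rewrite rmorphB /= -[c%:P]alg_polyC in_qpolyZ in_qpoly1.
(* For [0 < i], [k^i * k^j] is either [k^(i+j)] or, after wrapping around, [c * k^(i+j-n)]. The
   exponent exceeds [j] in the first case and is below [j] in the second, so neither meets the
   diagonal. *)
have entry (j : 'I_n) : Mbeta n z j j = qcoord z 0.
  rewrite mxE - {1}[z](qcoordK p_monic size_p) // mulr_suml qcoord_bigsum.
  rewrite (bigD1 (Ordinal n_gt0)) //= big1 => [|i i0].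
    rewrite addr0 [_ ^+ _]expr0 -scalerAl mul1r qcoordZ.
    by rewrite (qcoord_qX p_monic size_p) // eqxx mulr1.
  have {}i0 : (i : nat) != 0%N by [].
  rewrite -scalerAl qcoordZ -exprD; case: (ltnP (i + j) n) => [ij|ij].
    rewrite (qcoord_qX p_monic size_p) // -[X in X == _]add0n eqn_add2r.
    by rewrite eq_sym (negPf i0) mulr0.
  rewrite -(subnK ij) exprD kn -scalerAr mulr1 qcoordZ.
  have ij_lt : (i + j - n < j)%N by rewrite ltn_subLR // ltn_add2r.
  rewrite (qcoord_qX p_monic size_p) ?(ltn_trans ij_lt) //.
  by rewrite gtn_eqF // !mulr0.
rewrite /mxtrace (eq_bigr _ (fun j _ => entry j)) sumr_const card_ord.
by rewrite mulr_natl.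
Qed.

(** * Logarithms *)

Section ExpMorphism.
Variables (R : realType) (n : nat) (p : {poly R}) (r m : nat).
Hypotheses (p_monic : p \is monic) (size_p : size p = n.+1) (n_gt0 : (0 < n)%N).
Variable phi : {lrmorphism {poly %/ p} -> RrCm R r m}.
Implicit Type z : {poly %/ p}.

(** A real component of [phi] is a linear form, so it passes through the series; multiplicativity
    turns its terms into those of the real exponential. *)
Lemma expA_fst z a : (phi (expA n z)).1 a = expR ((phi z).1 a).
Proof.
have lf : scalar (fun w => (phi w).1 a).
  by move=> b v w; rewrite linearP /= !ffunE.
rewrite -(cvg_lim _ (@cvg_expA R n p p_monic size_p n_gt0 _ z lf)) //.
apply/cvg_lim => //; rewrite (_ : series _ = exp_sum ((phi z).1 a)).
  exact: cvg_exp_sum.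
apply/funext => N; rewrite /series /= big_mkord; apply: eq_bigr => l _.
rewrite linearZ /= ffunE /= mulrC; congr (_ * _).
elim: (l : nat) => [|q IHq]; first by rewrite !expr0 rmorph1 ffunE.
by rewrite !exprS rmorphM ffunE IHq.
Qed.

Lemma snd_expr z a (l : nat) :
  (phi (z ^+ l)).2 a = ((phi z).2 a : R[i]) ^+ l :> R[i].
Proof.
elim: l => [|q IHq]; first by rewrite !expr0 rmorph1 ffunE.
by rewrite !exprS rmorphM ffunE IHq.
Qed.

Lemma expA_snd z a : (phi (expA n z)).2 a = expC ((phi z).2 a : R[i]) :> R[i].
Proof.
have lf (g : Rcomplex R -> R) : scalar g -> scalar (fun w => g ((phi w).2 a)).
  by move=> g_scalar b v w; rewrite linearP /= !ffunE g_scalar.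
(* Scaling in [Rcomplex R] acts on the two parts separately and has to be matched with
   multiplication by a real complex number. *)
have term (l : nat) : (phi (l`!%:R^-1 *: z ^+ l)).2 a =
    ((phi z).2 a : R[i]) ^+ l / l`!%:R :> R[i].
  rewrite linearZ /= ffunE /= snd_expr.
  rewrite mulrC -(rmorph_nat (real_complex R)) -fmorphV /=.
  by case: (_ ^+ l) => x y; congr Complex; rewrite ?mul0r ?subr0 ?addr0.
have gsum (g : Rcomplex R -> R) : scalar g ->
    (fun N => g (exp_sum ((phi z).2 a : R[i]) N)) =
    series (fun l => g ((phi (l`!%:R^-1 *: z ^+ l)).2 a)).
  move=> g_scalar; apply/funext => N; rewrite /series /= big_mkord /exp_sum.
  under [RHS]eq_bigr do rewrite term.
  exact: (@scalar_fun_sum R (Rcomplex R) g _ _ xpredT _ g_scalar).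
apply: ccvg_unique (ccvg_exp_sum _); split.
  rewrite (gsum _ (@Re_is_scalar R)).
  exact: (@cvg_expA R n p p_monic size_p n_gt0 _ z (lf _ (@Re_is_scalar R))).
rewrite (gsum _ (@Im_is_scalar R)).
exact: (@cvg_expA R n p p_monic size_p n_gt0 _ z (lf _ (@Im_is_scalar R))).
Qed.

Lemma Ld_branch_domain (B : 'I_m -> set R[i]) z :
  bijective phi -> (forall i, is_log_branch (B i)) -> Ld n z ->
  exists u, branch_domain phi B u /\ expA n u = z.
Proof.
move=> phi_bij B_branch [u0 _ <-].
(* Exponentials are nonzero, so each branch reaches them. *)
have /choice[b b_exp] i : exists x : R[i],
    B i x /\ expC x = expC ((phi u0).2 i : R[i]).
  have [_ _ surjB] := B_branch i.
  have [x Bx xE] := surjB _ (expC_neq0 ((phi u0).2 i : R[i])).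
  by exists x; split; [exact: Bx | exact: xE].
have phi_inj := bij_inj phi_bij.
have [psi _ psiK] := phi_bij.
(* Surjectivity of [phi] realises the new complex components together with the old real ones. *)
have [u phi_u] : exists u, phi u = ((phi u0).1, [ffun i => b i]).
  by exists (psi ((phi u0).1, [ffun i => b i])); exact: psiK.
have fst_u i : (phi u).1 i = (phi u0).1 i by rewrite phi_u.
have snd_u i : (phi u).2 i = b i by rewrite phi_u ffunE.
exists u; split=> [i|]; first by rewrite snd_u; have [] := b_exp i.
have expE1 i : (phi (expA n u)).1 i = (phi (expA n u0)).1 i.
  apply: etrans (expA_fst u i) (etrans _ (esym (expA_fst u0 i))).
  by rewrite fst_u.
have expE2 i : (phi (expA n u)).2 i = (phi (expA n u0)).2 i.
  apply: etrans (expA_snd u i) (etrans _ (esym (expA_snd u0 i))).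
  by rewrite snd_u; have [] := b_exp i.
have ext (x y : RrCm R r m) :
    (forall i, x.1 i = y.1 i) -> (forall i, x.2 i = y.2 i) -> x = y.
  by case: x y => [x1 x2] [y1 y2] /= /ffunP -> /ffunP ->.
exact: phi_inj (ext _ _ expE1 expE2).
Qed.

End ExpMorphism.

Lemma LogA_polar (R : realType) (n : nat) (p : {poly R}) (c : R)
    (D : set {poly %/ p}) (z : {poly %/ p}) :
  (0 < n)%N -> p = 'X^n - c%:P -> (exists u, D u /\ expA n u = z) ->
  LogA n D z = (ln (modulus n z))%:A + ArgA n D z.
Proof.
move=> n_gt0 pE; have := monicXnsubC c n_gt0; have := size_XnsubC c n_gt0.
(* As a logarithm exists in [D], [LogA] is one and not the default 0. *)
rewrite -pE => size_p p_monic /(xgetPex 0) [_]; rewrite -/(LogA n D z) => expL.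
have modE : modulus n z = expR (qcoord (LogA n D z) 0).
  rewrite /modulus - {1}expL (det_Mbeta_expA _ p_monic size_p n_gt0).
  move: (LogA n D z); rewrite pE => L.
  (* The root undoes the factor [n] of the trace: [(e^(n u_0))^(1/n) = e^(u_0)]. *)
  rewrite mxtrace_Mbeta // expRM_natl -powR_mulrn ?expR_ge0 // -powRrM.
  by rewrite mulfV ?powRr1 ?expR_ge0 // pnatr_eq0 -lt0n.
rewrite modE expRK /ArgA - {1}[LogA n D z](qcoordK p_monic size_p n_gt0).
rewrite -(big_mkord xpredT (fun i => qcoord (LogA n D z) i *: 'qX ^+ i)).
by rewrite big_ltn.
Qed.

Theorem corollary2p11 (R : realType) (n : nat) (n_gt0 : (0 < n)%N) :
  (forall p : {poly R}, p = 'X^n - 1 \/ p = 'X^n + 1 ->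
    forall (r m : nat) (phi : {lrmorphism {poly %/ p} -> RrCm R r m})
      (B : 'I_m -> set R[i]),
    bijective phi -> (forall i, is_log_branch (B i)) ->
    forall z : {poly %/ p}, Ld n z ->
      LogA n (branch_domain phi B) z
      = (ln (modulus n z))%:A + ArgA n (branch_domain phi B) z)
  /\
  (forall z : {poly %/ ('X^n : {poly R})}, Ld n z ->
      LogA n [set: {poly %/ ('X^n : {poly R})}] z
      = (ln (modulus n z))%:A + ArgA n [set: {poly %/ ('X^n : {poly R})}] z).
Proof.
split=> [p pE r m phi B phi_bij B_branch z Ldz | z [u _ uz]]; last first.
  (* The nilpotent case is [c = 0]; the semisimple ones below are [c = 1] and [c = -1]. *)
  apply: (@LogA_polar _ _ _ 0) => //; first by rewrite subr0.
  by exists u.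
have [c pXc] : exists c, p = 'X^n - c%:P.
  case: pE => ->; first by exists 1.
  by exists (-1); rewrite polyCN opprK.
apply: (LogA_polar n_gt0 pXc); apply: Ld_branch_domain => //.
- by rewrite pXc monicXnsubC.
- by rewrite pXc size_XnsubC.
Qed.
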